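(* Let $n\ge 1$, let $\mathfrak i\in\mathcal I^n$ be an ad-nilpotent ideal, and let $\lambda=(\lambda_1,\ldots,\lambda_n)$ be the corresponding partition (contained in the staircase $(n,n-1,\ldots,1)$). If $\lambda\neq(0,0,\ldots,0)$, then $$n(\lambda_1,\lambda_2,\ldots,\lambda_n)=n(\lambda_{n+2-\lambda_1},\ldots,\lambda_n)+1 ,$$ where $n(\cdot)$ of a partition denotes the class of nilpotence of the ideal corresponding to it: on the left-hand side an ideal in $\mathcal I^n$, on the right-hand side an ideal in $\mathcal I^{\lambda_1-1}$.
   Context: For $n\ge1$ let $\mathfrak g=sl(n+1,\mathbb C)$ with a fixed Cartan subalgebra $\mathfrak h$, positive roots $\Delta^+$, simple roots $\alpha_1,\dots,\alpha_n$ (numbered along the Dynkin diagram of type $A_n$), root spaces $\mathfrak g_\alpha$, and Borel subalgebra $\mathfrak b=\mathfrak h\oplus\bigoplus_{\alpha\in\Delta^+}\mathfrak g_\alpha$. $\mathcal I^n$ is the set of ad-nilpotent ideals of $\mathfrak b$, i.e. ideals of $\mathfrak b$ consisting of ad-nilpotent elements. Each $\mathfrak i\in\mathcal I^n$ has the form $\mathfrak i=\bigoplus_{\alpha\in\Phi}\mathfrak g_\alpha$ for some $\Phi\subseteq\Delta^+$. Correspondence with partitions: write the positive roots as $\tau_{ij}=\alpha_i+\alpha_{i+1}+\dots+\alpha_{n-j+1}$, $1\le i\le n$, $1\le j\le n-i+1$, and identify $\tau_{ij}$ with the cell $(i,j)$ (row $i$, column $j$) of the staircase Ferrers diagram $(n,n-1,\dots,1)$.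 The cells corresponding to the roots in $\Phi$ form the Ferrers diagram of a partition $\lambda=(\lambda_1\ge\dots\ge\lambda_n\ge0)$ contained in $(n,n-1,\dots,1)$; this gives a bijection between $\mathcal I^n$ and the partitions contained in $(n,n-1,\dots,1)$. Class of nilpotence: put $\mathfrak i^1=\mathfrak i$, $\mathfrak i^{m}=[\mathfrak i^{m-1},\mathfrak i]$ (so $\mathfrak i^m$ involves $m$ occurrences of $\mathfrak i$). The class of nilpotence $n(\mathfrak i)$ is the smallest $m\ge0$ with $\mathfrak i^{m+1}=0$ (so the zero ideal has class $0$, and Abelian ideals are exactly those of class at most $1$). When $\lambda_1=1$ the list $(\lambda_{n+2-\lambda_1},\ldots,\lambda_n)$ is empty; it corresponds to the zero ideal and has class of nilpotence $0$. *)

(* Defs.v *)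
From HB Require Import structures.
From mathcomp Require Import all_boot all_order all_algebra.
From mathcomp Require Import boolp reals complex.

Set Implicit Arguments.
Unset Strict Implicit.
Unset Printing Implicit Defensive.

Import GRing.Theory Num.Theory.

Local Open Scope ring_scope.

Section LieAlgebra.
Variables (K : fieldType) (d : nat).
Implicit Types (X Y Z : 'M[K]_d) (U V W : {vspace 'M[K]_d}).

Definition lie X Y : 'M[K]_d := X *m Y - Y *m X.

Lemma lie_is_linear X : linear (lie X).
Proof.
move=> a Y Z; rewrite /lie mulmxDr mulmxDl -scalemxAr -scalemxAl scalerBr.
by rewrite opprD addrACA.
Qed.

HB.instance Definition _ X :=
  GRing.isLinear.Build K 'M[K]_d 'M[K]_d _ (lie X) (lie_is_linear X).

Lemma lieC X Y : lie X Y = - lie Y X.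
Proof. by rewrite /lie opprB. Qed.

(* The linear span of all lie X Y with X in U and Y in V (see lievP); the use
   of bases follows the definition of prodv in falgebra. *)
Definition liev U V : {vspace 'M[K]_d} :=
  <<[seq lie X Y | X <- vbasis U, Y <- vbasis V]>>%VS.

Lemma lievP U V W :
  reflect (forall X Y, X \in U -> Y \in V -> lie X Y \in W) (liev U V <= W)%VS.
Proof.
apply: (iffP span_subvP) => [sUVW X Y UX VY | sUVW Z].
  rewrite (coord_vbasis VY) linear_sum memv_suml //= => j _.
  rewrite linearZ memvZ //= lieC memvN (coord_vbasis UX) linear_sum.
  rewrite memv_suml //= => i _; rewrite linearZ memvZ //= lieC memvN sUVW //.
  by apply: allpairs_f; apply: mem_nth; rewrite size_tuple.
by case/allpairsP=> -[X Y] /= [UX VY ->]; apply: sUVW; apply: vbasis_mem.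
Qed.

(* liepow U m is the m-th power of U, for m >= 1, so that m counts the
   occurrences of U; liepow U 0 = U is a dummy value. *)
Fixpoint liepow U m : {vspace 'M[K]_d} :=
  if m is (m'.+1 as m1).+1 then liev (liepow U m1) U else U.

(* The value for a U none of whose powers vanishes is a dummy one. *)
Definition nilpotence_class U : nat :=
  if pselect (exists m, liepow U m.+1 == 0%VS) is left exU0
  then ex_minn exU0 else 0%N.

Lemma nilpotence_classP U m :
    liepow U m.+1 = 0%VS -> (forall k, (k < m)%N -> liepow U k.+1 <> 0%VS) ->
  nilpotence_class U = m.
Proof.
move=> Um0 minm; rewrite /nilpotence_class.
case: pselect => [exU0 | []]; last by exists m; apply/eqP.
case: ex_minnP => k /eqP Uk0 mink; apply/eqP; rewrite eqn_leq mink ?Um0 //=.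
by rewrite leqNgt; apply/negP => /minm.
Qed.

End LieAlgebra.

Section SpecialLinear.
Variables (R : realType) (n : nat).
Local Notation C := R[i].
Local Notation M := 'M[C]_n.+1.
Implicit Types (X Y H : M) (I : {vspace M}).

Definition sl : {vspace M} := lker (linfun (@mxtrace C n.+1 : M -> C^o)).

Definition cartan : {vspace M} :=
  (sl :&: \sum_(k < n.+1) <[delta_mx k k]>)%VS.

(* The simple root alpha_(k+1), for k < n, extended from the diagonal matrices
   to all matrices. *)
Definition simple_root_fun (k : nat) H : C^o :=
  H (inord k) (inord k) - H (inord k.+1) (inord k.+1).

Lemma simple_root_fun_is_linear k : linear (simple_root_fun k).
Proof.
by move=> a X Y; rewrite /simple_root_fun !mxE scalerBr opprD addrACA.
Qed.

HB.instance Definition _ k :=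
  GRing.isLinear.Build C M C^o _ (simple_root_fun k)
    (simple_root_fun_is_linear k).

Definition simple_root k : 'Hom(M, C^o) := linfun (simple_root_fun k).

(* With rows and columns numbered from 0, the cell (i, j) of the staircase,
   i + j < n, carries alpha_(i+1) + ... + alpha_(n-j). *)
Definition tau (i j : nat) : 'Hom(M, C^o) :=
  \sum_(i <= k < n - j) simple_root k.

Definition weight_fun (a : 'Hom(M, C^o)) H X : M := lie H X - (a H : C) *: X.

Lemma weight_fun_is_linear a H : linear (weight_fun a H).
Proof.
move=> c X Y; rewrite /weight_fun linearP scalerBr scalerDr !scalerA.
by rewrite [_ * c]mulrC opprD addrACA.
Qed.

HB.instance Definition _ (a : 'Hom(M, C^o)) H :=
  GRing.isLinear.Build C M M _ (weight_fun a H) (weight_fun_is_linear a H).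

Definition root_space (a : 'Hom(M, C^o)) : {vspace M} :=
  (sl :&: \bigcap_(H <- vbasis cartan) lker (linfun (weight_fun a H)))%VS.

Lemma root_spaceP (a : 'Hom(M, C^o)) X :
  reflect (X \in sl /\ forall H, H \in cartan -> lie H X = (a H : C) *: X)
          (X \in root_space a).
Proof.
rewrite /root_space memv_cap; apply: (iffP andP) => -[slX aX]; split=> //.
- have aXb G : G \in vbasis cartan -> lie G X = (a G : C) *: X.
    move=> hG; move: aX; rewrite (bigD1_seq G) ?free_uniq //=; last first.
      exact: basis_free (vbasisP _).
    by rewrite memv_cap memv_ker lfunE /= subr_eq0 => /andP[/eqP].
  move=> H hH; rewrite lieC {1}(coord_vbasis hH) linear_sum -sumrN.
  rewrite {2}(coord_vbasis hH) linear_sum scaler_suml; apply: eq_bigr => i _.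
  rewrite !linearZ /= -lieC aXb; last by apply: mem_nth; rewrite size_tuple.
  by rewrite scalerA.
- rewrite big_seq; elim/big_ind: _ => [|U V UX VX|H hH]; first exact: memvf.
    by rewrite memv_cap UX.
  by rewrite memv_ker lfunE /= subr_eq0 aX // vbasis_mem.
Qed.

Definition borel : {vspace M} :=
  (cartan + \sum_(i < n) \sum_(j < n - i) root_space (tau i j))%VS.

Definition ad_nilpotent X : Prop :=
  exists k, forall Y, Y \in sl -> iter k (lie X) Y = 0.

Definition ad_nilpotent_ideal I : Prop :=
  [/\ (I <= borel)%VS, (liev borel I <= I)%VS
    & forall X, X \in I -> ad_nilpotent X].

(* Partitions contained in the staircase are lists of n parts, padded with
   zeros. *)
Definition staircase_partition (lam : seq nat) : Prop :=
  [/\ size lam = n, sorted geq lam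
    & forall i, (i < n)%N -> (nth 0%N lam i <= n - i)%N].

Definition partition_ideal (lam : seq nat) : {vspace M} :=
  (\sum_(i < n) \sum_(j < n - i | (j < nth 0 lam i)%N)
     root_space (tau i j))%VS.

Definition corresponding_partition I (lam : seq nat) : Prop :=
  staircase_partition lam /\ I = partition_ideal lam.

Definition partition_class (lam : seq nat) : nat :=
  nilpotence_class (partition_ideal lam).

End SpecialLinear.

(* Main.v *)
(* Number the rows and columns of matrices from 0 to n. The ideal of lam is
   spanned by the elementary matrices E_pq with g p <= q, where
   g p = n + 1 - lam_p, and its m-th power by those with g^m p <= q. Hence the
   class of nilpotence is the least m with g^(m+1) 0 > n. Deleting the first
   s = g 0 parts of lam conjugates g by the shift by s, so that the orbit of 0
   for the shorter partition is the orbit of 0 for lam without its first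
   step. *)
Require Import Defs.
From mathcomp Require Import all_boot all_order all_algebra.
From mathcomp Require Import boolp reals complex.
From mathcomp Require Import zify.

Set Implicit Arguments.
Unset Strict Implicit.
Unset Printing Implicit Defensive.

Import GRing.Theory Num.Theory.

Local Open Scope ring_scope.

(** * Spans of elementary matrices and their brackets *)

Section SupportedMatrices.
Variables (K : fieldType) (d : nat).
Implicit Types (P Q : rel 'I_d) (X Y : 'M[K]_d).

(** Partition ideals and their powers all have this form, so inclusions between them reduce to
    tracking positions of nonzero entries. *)
Definition supported P : {vspace 'M[K]_d} :=
  (\sum_(x : 'I_d * 'I_d | P x.1 x.2) <[delta_mx x.1 x.2]>)%VS.

Lemma supportedP P X :
  reflect (forall p q, X p q != 0 -> P p q) (X \in supported P).
Proof.
apply: (iffP idP) => [/memv_sumP[vs vsP ->] p q | XP].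
  apply: contraNT => nPpq; rewrite summxE big1 // => -[i j] /= Pij.
  have /vlineP[c ->] := vsP (i, j) Pij; rewrite !mxE.
  have [pi|] := eqVneq p i; have [qj|] := eqVneq q j; rewrite ?mulr0 //.
  by rewrite pi qj Pij in nPpq.
rewrite [X]matrix_sum_delta; apply: memv_suml => p _; apply: memv_suml => q _.
have [->|Xpq] := eqVneq (X p q) 0; first by rewrite scale0r mem0v.
by apply/memvZ/(subvP (sumv_sup (p, q) (XP p q Xpq) (subvv _)))/memv_line.
Qed.

Lemma delta_supported P p q : P p q -> delta_mx p q \in supported P.
Proof.
move=> Ppq; apply/supportedP=> i j; rewrite mxE.
by have [->|_] := eqVneq i p; have [->|_] := eqVneq j q; rewrite ?eqxx.
Qed.

Lemma mulmx_neq0 X Y p q : (X *m Y) p q != 0 ->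
  exists2 r, X p r != 0 & Y r q != 0.
Proof.
move=> XYpq; apply/exists2P; apply: contrapT => nr; case/negP: XYpq.
rewrite mxE big1 // => r _; apply/eqP; rewrite mulf_eq0.
by apply/norP => -[Xpr Yrq]; apply: nr; exists r.
Qed.

Lemma lie_neq0 X Y p q : lie X Y p q != 0 ->
  exists r, X p r != 0 /\ Y r q != 0 \/ Y p r != 0 /\ X r q != 0.
Proof.
have -> : lie X Y p q = (X *m Y) p q - (Y *m X) p q by rewrite !mxE.
have [->|] := eqVneq ((X *m Y) p q) 0.
  rewrite sub0r oppr_eq0 => /mulmx_neq0[r ? ?].
  by exists r; right.
by move=> /mulmx_neq0[r ? ?] _; exists r; left.
Qed.

Lemma lie_delta p r q : p != q ->
  lie (delta_mx p r) (delta_mx r q) = delta_mx p q :> 'M[K]_d.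
Proof.
by move=> pq; rewrite /lie mul_delta_mx mul_delta_mx_0 ?subr0 // eq_sym.
Qed.

End SupportedMatrices.

(** * Iterating the row-start function of a partition *)

Section StaircasePartition.
Variables (n : nat) (lam : seq nat).
Hypothesis lam_stair : staircase_partition n lam.

Lemma staircase_nth_le p : (nth 0 lam p <= n - p)%N.
Proof.
have [sz _ le_lam] := lam_stair; have [/le_lam //|np] := ltnP p n.
by rewrite nth_default ?sz.
Qed.

Lemma staircase_nth_anti p q : (p <= q)%N -> (nth 0 lam q <= nth 0 lam p)%N.
Proof.
have [sz so _] := lam_stair => pq; have [qn|nq] := ltnP q n; last first.
  by rewrite nth_default ?sz.
apply: (sorted_leq_nth (rev_trans leq_trans) leqnn 0%N so) => //.
  by rewrite inE sz (leq_ltn_trans pq).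
by rewrite inE sz.
Qed.

(* For p <= n, the first column of row p occupied by the ideal of lam, or
   n + 1 if there is none. *)
Definition row_start (p : nat) : nat := (n.+1 - nth 0 lam p)%N.

Lemma row_start_mono p q : (p <= q)%N -> (row_start p <= row_start q)%N.
Proof. by move/staircase_nth_anti; rewrite /row_start; lia. Qed.

Lemma iter_row_start_mono m p q :
  (p <= q)%N -> (iter m row_start p <= iter m row_start q)%N.
Proof. by move=> pq; elim: m => //= m; apply: row_start_mono. Qed.

Lemma row_start_gt p : (p <= n)%N -> (p < row_start p)%N.
Proof. by have := staircase_nth_le p; rewrite /row_start; lia. Qed.

(** The bound is on the value: [row_start] is n + 1 from p = n on, so a value at most n forces p <
    n. *)
Lemma row_start_le p : (row_start p <= n)%N -> (p < row_start p)%N.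
Proof. by have := staircase_nth_le p; rewrite /row_start; lia. Qed.

Lemma iter_row_start_ge m p :
  (iter m row_start p <= n)%N -> (p <= iter m row_start p)%N.
Proof.
elim: m => //= m IHm h; have lt_m := row_start_le h.
by rewrite (leq_trans (IHm _)) // ltnW // (leq_trans lt_m).
Qed.

(** A value at most n increases by at least one at each step, and a value beyond n is sent to n +
    1. *)
Lemma iter_row_start_unbounded : exists m, (n < iter m.+1 row_start 0)%N.
Proof.
suff min_le m : (minn m n.+1 <= iter m row_start 0)%N.
  by exists n; have := min_le n.+1; rewrite minnn.
elim: m => [|m IHm]; first by rewrite min0n.
rewrite iterS; set r := iter m _ _ in IHm *.
have [/row_start_gt|] := leqP r n; first by lia.
by have := staircase_nth_le r; rewrite /row_start; lia.
Qed.

End StaircasePartition.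

(** * Root spaces, partition ideals and their powers *)

Section PartitionIdeal.
Variables (R : realType) (n : nat).
Local Notation C := R[i].
Local Notation M := 'M[C]_n.+1.

Lemma mem_sl (X : M) : (X \in sl R n) = (\tr X == 0).
Proof. by rewrite memv_ker lfunE. Qed.

Lemma mxtrace_delta (p q : 'I_n.+1) : \tr (delta_mx p q : M) = (p == q)%:R.
Proof.
rewrite /mxtrace (bigD1 p) //= mxE eqxx big1 ?addr0 // => k /negPf kp.
by rewrite mxE kp.
Qed.

Lemma cartan_offdiag (H : M) p q : H \in cartan R n -> p != q -> H p q = 0.
Proof.
rewrite memv_cap => /andP[_ /memv_sumP[vs vsP ->]] pq.
rewrite summxE big1 // => k _; have /vlineP[c ->] := vsP k isT; rewrite !mxE.
have [pk|] := eqVneq p k; have [qk|] := eqVneq q k; rewrite ?mulr0 //.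
by rewrite pk qk eqxx in pq.
Qed.

Lemma cartan_delta (i k : 'I_n.+1) :
  delta_mx i i - delta_mx k k \in cartan R n.
Proof.
rewrite memv_cap mem_sl linearB /= !mxtrace_delta !eqxx subrr eqxx /=.
by apply: memvB; apply: (subvP (sumv_sup _ isT (subvv _))); apply: memv_line.
Qed.

Lemma tauE (H : M) (i j : nat) : (i + j < n)%N ->
  tau R n i j H = H (inord i) (inord i) - H (inord (n - j)) (inord (n - j)).
Proof.
move=> ijn; rewrite sum_lfunE.
under eq_bigr => k _ do rewrite lfunE /= /simple_root_fun -opprB.
rewrite sumrN (telescope_sumr (fun k => H (inord k) (inord k))) ?opprB //.
by lia.
Qed.

Lemma lie_diag (H X : M) p q : H \in cartan R n ->
  lie H X p q = (H p p - H q q) * X p q.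
Proof.
move=> hH; rewrite !mxE (bigD1 p) //= (bigD1 q (P := predT)) //=.
rewrite big1 => [|r rp]; last by rewrite cartan_offdiag ?mul0r // eq_sym.
rewrite big1 => [|r rp]; last by rewrite (@cartan_offdiag H r q) ?mulr0.
by rewrite !addr0 mulrBl [X p q * _]mulrC.
Qed.

Lemma root_space_tau (i j : nat) : (i + j < n)%N ->
  root_space (tau R n i j) = <[delta_mx (inord i) (inord (n - j))]>%VS.
Proof.
move=> ijn; set a : 'I_n.+1 := inord i; set b : 'I_n.+1 := inord (n - j).
have ab : a != b by rewrite -val_eqE /= !inordK; lia.
apply/vspaceP => X; apply/root_spaceP/vlineP => [[_ wX] | [c ->]].
  exists (X a b); apply/matrixP=> p q.
  (* H = E_aa - E_bb acts on E_pq by the integer w p - w q, which is equal to 2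
     only for E_ab. *)
  pose w (k : 'I_n.+1) : int := (k == a)%:Z - (k == b)%:Z.
  have wE k : (delta_mx a a - delta_mx b b : M) k k = (w k)%:~R.
    by rewrite !mxE !andbb rmorphB.
  have wab : w a - w b = 2%:Z by rewrite /w !eqxx [b == a]eq_sym (negPf ab).
  have := congr1 (fun Y : M => Y p q) (wX _ (cartan_delta a b)).
  rewrite lie_diag ?cartan_delta // tauE // -/a -/b !wE !mxE -!rmorphB wab.
  have [->|pa] /= := eqVneq p a; have [->|qb] /= := eqVneq q b;
    rewrite ?mulr1 // mulr0 => /eqP;
    rewrite -subr_eq0 -mulrBl -rmorphB mulf_eq0 intr_eq0 => /orP[|/eqP //];
    rewrite /w ?eqxx ?(negPf ab) ?(negPf pa) ?(negPf qb).
  - by case: (q == a).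
  - by rewrite [b == a]eq_sym (negPf ab); case: (p == b).
  - by case: (p == b); case: (q == a).
split=> [|H hH].
  by rewrite mem_sl linearZ /= mxtrace_delta (negPf ab) mulr0.
apply/matrixP=> p q; rewrite lie_diag // tauE // -/a -/b !mxE.
by have [->|] := eqVneq p a; have [->|] := eqVneq q b; rewrite /= ?mulr0.
Qed.

(** The cell (i, j) is the matrix position (i, n - j), so the first lam_i cells of row i fill the
    last lam_i columns. Row n has no cells, which agrees with its row start n + 1. *)
Lemma partition_idealE lam : staircase_partition n lam ->
  partition_ideal R n lam =
  supported _ (fun p q : 'I_n.+1 => row_start n lam p <= q)%N.
Proof.
move=> lam_stair; apply/eqP; rewrite eqEsubv; apply/andP; split.
  apply/subv_sumP => i _; apply/subv_sumP => j jlam; have ltj := ltn_ord j.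
  have lti := ltn_ord i; rewrite root_space_tau; last by lia.
  rewrite -memvE; apply: delta_supported.
  by rewrite !inordK /row_start; lia.
apply/subv_sumP => -[p q] /= pq.
have ltq := ltn_ord q; have ltp := ltn_ord p.
have lt_pq := row_start_le lam_stair (leq_trans pq ltq).
have lt_pn : (p < n)%N by lia.
have lt_j : (n - q < n - Ordinal lt_pn)%N by rewrite /=; lia.
apply: (sumv_sup (Ordinal lt_pn)) => //.
apply: (sumv_sup (Ordinal lt_j)); first by rewrite /= /row_start in pq *; lia.
rewrite root_space_tau /=; last by lia.
by rewrite subKn ?inord_val //; lia.
Qed.

(** Stability under the upper triangular matrices comes from the monotonicity of [row_start];
    ad-nilpotency holds because the ideal lies strictly above the diagonal. *)
Lemma partition_ideal_ad_nilpotent lam : staircase_partition n lam ->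
  ad_nilpotent_ideal (partition_ideal R n lam).
Proof.
move=> lam_stair; split.
- apply: subv_trans (addvSr _ _); apply/subv_sumP => i _.
  apply: (sumv_sup i) => //; apply/subv_sumP => j _.
  exact: sumv_sup (subvv _).
- have borel_upper :
    (borel R n <= supported _ (fun p q : 'I_n.+1 => p <= q)%N)%VS.
    rewrite subv_add; apply/andP; split.
      apply/subvP => H hH; apply/supportedP => p q.
      have [-> //|pq] := eqVneq p q.
      by rewrite (cartan_offdiag hH pq) eqxx.
    apply/subv_sumP => i _; apply/subv_sumP => j _.
    have lti := ltn_ord i; have ltj := ltn_ord j.
    rewrite root_space_tau; last by lia.
    by rewrite -memvE; apply: delta_supported; rewrite !inordK; lia.
  rewrite partition_idealE //; apply/lievP => X Y /(subvP borel_upper).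
  move=> /supportedP XP /supportedP YP; apply/supportedP => p q.
  case/lie_neq0 => r [] [].
    move=> /XP pr /YP; apply: leq_trans.
    exact: (row_start_mono lam_stair).
  by move=> /YP pr /XP; apply: leq_trans.
- rewrite partition_idealE // => X /supportedP XP; exists (n.+1).*2 => Y _.
  (* Each bracket with X moves the support up by at least one diagonal, starting from q - p >= -n.
     As q - p <= n, at most 2n brackets can leave a nonzero entry. *)
  have nilX k p q : iter k (lie X) Y p q != 0 -> (p + k <= q + n)%N.
    elim: k p q => [|k IHk] p q /=; first by have := ltn_ord p; lia.
    case/lie_neq0 => r [] [].
      move=> /XP pr /IHk; have := ltn_ord p.
      by have := @row_start_gt _ _ lam_stair p; lia.
    move=> /IHk pr /XP; have := ltn_ord r.
    by have := @row_start_gt _ _ lam_stair r; lia.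
  apply/matrixP => p q; rewrite [RHS]mxE; apply/eqP/negPn/negP => /nilX.
  by have := ltn_ord q; lia.
Qed.

(** Multiplying matrices composes the bounds on their rows, and both orders of the product in a
    bracket yield the same iterate. *)
Lemma liepow_partition_ideal lam m : staircase_partition n lam ->
  liepow (partition_ideal R n lam) m.+1 =
  supported _ (fun p q : 'I_n.+1 => iter m.+1 (row_start n lam) p <= q)%N.
Proof.
move=> lam_stair; have mono := row_start_mono lam_stair.
have iter_mono := iter_row_start_mono lam_stair.
rewrite partition_idealE //; elim: m => [//|m IHm].
rewrite [liepow _ _]/= -/(liepow _ m.+1) {}IHm; apply/eqP; rewrite eqEsubv.
apply/andP; split.
  apply/lievP => X Y /supportedP XP /supportedP YP; apply/supportedP => p q.
  case/lie_neq0 => r [] [].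
    by move=> /XP pr /YP; apply: leq_trans; rewrite iterS mono.
  by move=> /YP pr /XP; apply: leq_trans; rewrite iterSr iter_mono.
apply/subv_sumP => -[p q] /= pq; have ltq := ltn_ord q.
(* E_pq is the bracket of E_pr and E_rq for r the (m+1)-st iterate at p: the first lies in the
   previous power, the second in the ideal, and p <= r < q. *)
set r := row_start n lam (iter m _ _) in pq.
have lt_rq := row_start_le lam_stair (leq_trans pq ltq).
have lt_rn : (r < n.+1)%N by lia.
have le_pr : (p <= r)%N by apply: (@iter_row_start_ge _ _ lam_stair m.+1).
have pqF : p != q by rewrite -val_eqE /=; lia.
rewrite -memvE -(@lie_delta _ _ p (Ordinal lt_rn)) //.
have /lievP := subvv (liev (supported C
  (fun p q : 'I_n.+1 => iter m.+1 (row_start n lam) p <= q)%N)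
  (supported C (fun p q : 'I_n.+1 => row_start n lam p <= q)%N)).
by apply; apply: delta_supported.
Qed.

(** By monotonicity of the iterates, a nonzero power contains the top right corner E_0n. *)
Lemma liepow_partition_ideal_eq0 lam m : staircase_partition n lam ->
  (liepow (partition_ideal R n lam) m.+1 == 0%VS) =
  (n < iter m.+1 (row_start n lam) 0)%N.
Proof.
move=> lam_stair; rewrite liepow_partition_ideal //; apply/eqP/idP => [I0|gt_n].
  rewrite ltnNge; apply/negP => le_n.
  have : delta_mx ord0 ord_max \in (0%VS : {vspace M}).
    by rewrite -I0; apply: delta_supported.
  rewrite memv0 => /eqP/matrixP/(_ ord0 ord_max); rewrite !mxE !eqxx.
  by move/eqP; rewrite oner_eq0.
apply: big_pred0 => -[p q] /=; apply/negbTE; rewrite -ltnNge.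
have ltq := ltn_ord q; apply: (leq_trans ltq); apply: (leq_trans gt_n).
exact: (@iter_row_start_mono _ _ lam_stair m.+1 0).
Qed.

Lemma partition_classP lam m : staircase_partition n lam ->
    (n < iter m.+1 (row_start n lam) 0)%N ->
    (forall k, (k < m)%N -> (iter k.+1 (row_start n lam) 0 <= n)%N) ->
  partition_class R n lam = m.
Proof.
move=> lam_stair gt_n le_n; apply: nilpotence_classP => [|k /le_n le_kn].
  by apply/eqP; rewrite liepow_partition_ideal_eq0.
by apply/eqP; rewrite liepow_partition_ideal_eq0 // -leqNgt.
Qed.

End PartitionIdeal.

(** * Deleting the first parts of a partition *)

Section RemoveFirstParts.
Variables (n : nat) (lam : seq nat).
Hypothesis lam_stair : staircase_partition n lam.
Hypothesis lam_neq0 : lam <> nseq n 0%N.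
Let n' := (nth 0 lam 0 - 1)%N.
(** Counted from 0, the part numbered n + 2 - lam_1 in the usual notation has index n + 1 -
    lam_0. *)
Let lam' := drop (n + 1 - nth 0 lam 0)%N lam.

Lemma staircase_nth0_gt0 : (0 < nth 0 lam 0)%N.
Proof.
rewrite lt0n; apply/eqP => lam0; apply: lam_neq0; have [sz _ _] := lam_stair.
apply: (@eq_from_nth _ 0%N) => [|i _]; first by rewrite size_nseq.
have := staircase_nth_anti lam_stair (leq0n i).
by rewrite lam0 nth_nseq if_same; lia.
Qed.

Lemma staircase_drop : staircase_partition n' lam'.
Proof.
have lam0 := staircase_nth0_gt0; have le_lam0 := staircase_nth_le lam_stair 0.
have [sz so _] := lam_stair; split.
- by rewrite size_drop sz /n'; lia.
- exact: drop_sorted.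
- move=> i; have := staircase_nth_le lam_stair (n + 1 - nth 0 lam 0 + i)%N.
  by rewrite nth_drop /n'; lia.
Qed.

(** With s = n + 1 - lam_0, both s + (n' + 1 - lam'_r) and the row start at s + r equal n + 1 -
    lam_(s+r). *)
Lemma iter_row_start_drop m :
  (row_start n lam 0 + iter m (row_start n' lam') 0 =
   iter m.+1 (row_start n lam) 0)%N.
Proof.
have lam0 := staircase_nth0_gt0; have le_lam0 := staircase_nth_le lam_stair 0.
elim: m => [|m IHm]; first by rewrite addn0.
rewrite iterS [in RHS]iterS -{}IHm; set r := iter m _ 0.
(* The bound lam_(s+r) <= lam_0 = n' + 1 makes the truncated subtraction for the shorter partition
   exact. *)
have := staircase_nth_anti lam_stair (leq0n (row_start n lam 0 + r)).
by rewrite /row_start nth_drop /n' addn1; lia.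
Qed.

End RemoveFirstParts.

(** * The recursion for the class of nilpotence *)

Theorem proposition3p2 (R : realType) (n : nat) (I : {vspace 'M[R[i]]_n.+1})
    (lam : seq nat) (n_ge1 : (1 <= n)%N)
    (I_ideal : ad_nilpotent_ideal I) (I_lam : corresponding_partition I lam)
    (lam_neq0 : lam <> nseq n 0%N) :
  let n' := (nth 0 lam 0 - 1)%N in
  let lam' := drop (n + 1 - nth 0 lam 0)%N lam in
  [/\ staircase_partition n' lam',
      ad_nilpotent_ideal (partition_ideal R n' lam')
    & partition_class R n lam = (partition_class R n' lam' + 1)%N].
Proof.
have [lam_stair _] := I_lam => n' lam'.
have lam'_stair : staircase_partition n' lam' by apply: staircase_drop.
split=> //; first exact: partition_ideal_ad_nilpotent.
have lam0 := staircase_nth0_gt0 lam_stair lam_neq0.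
have le_lam0 := staircase_nth_le lam_stair 0.
(* The two orbits differ by s = n + 1 - lam_0, and n = s + n', so both thresholds are crossed
   together, one step apart. *)
have shift m : (n < iter m.+1 (row_start n lam) 0)%N =
               (n' < iter m (row_start n' lam') 0)%N.
  rewrite -iter_row_start_drop // -/n' -/lam' /row_start -/(row_start n' lam').
  by rewrite /n'; lia.
have exm := iter_row_start_unbounded lam'_stair.
case: (ex_minnP exm) => m gt_m min_m.
have min_m' k : (k < m)%N -> (iter k.+1 (row_start n' lam') 0 <= n')%N.
  by move=> ltkm; rewrite leqNgt; apply/negP => /min_m; rewrite leqNgt ltkm.
rewrite (partition_classP R lam'_stair gt_m min_m') addn1.
(* For k = 0, [shift] reduces the bound to the falsity of n' < 0: the ideal of [lam] is nonzero. *)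
apply: partition_classP => // [|[_|k ltk]]; first by rewrite shift.
  by rewrite leqNgt shift.
by rewrite leqNgt shift -leqNgt min_m'.
Qed.
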